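(* Let $X$ be a separable Banach space, $p,q\in[1,+\infty)$, and let $(M_n,d_n)$, $n\in\mathbb N$, be separable complete metric spaces. Suppose there are $A,C,D>0$, Borel maps $T_n:M_n\to\ell_q(X)$, and non-negative reals $\varepsilon_n,\delta_n$ ($n\in\mathbb N$) such that: (1) $\sum_n\varepsilon_n^p<+\infty$ and $\sum_n\delta_n^q<+\infty$; (2) for $u,v\in M_n$, $d_n(u,v)<\varepsilon_n\Rightarrow\|T_n(u)-T_n(v)\|_{X,q}<\delta_n$; (3) $d_n(u,v)>C\Rightarrow\|T_n(u)-T_n(v)\|_{X,q}>D$; (4) $\varepsilon_n\le d_n(u,v)\le C\Rightarrow\frac1A d_n(u,v)^{p/q}\le\|T_n(u)-T_n(v)\|_{X,q}\le A d_n(u,v)^{p/q}$. Then $E((M_n)_{n\in\mathbb N},p)\le_B E(X,q)$.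
   Context: $\ell_q(X)$ is the Banach space of $x\in X^{\mathbb N}$ with $\|x\|_{X,q}=(\sum_n\|x(n)\|_X^q)^{1/q}<\infty$. For separable complete metric spaces $(M_n,d_n)$ and $p\in[1,\infty)$, $E((M_n)_{n},p)$ is the equivalence relation on $\prod_nM_n$ given by $(x,y)\in E\iff\sum_nd_n(x(n),y(n))^p<+\infty$; $E(X,q)$ denotes this relation with all $M_n=X$ (norm metric), i.e. $X^{\mathbb N}/\ell_q(X)$. $E\le_B F$ means there is a Borel map $\theta$ with $(x,y)\in E\iff(\theta(x),\theta(y))\in F$. *)

(* Defs.v *)
From HB Require Import structures.
From mathcomp Require Import all_boot all_order all_algebra.
From mathcomp Require Import all_classical all_reals all_analysis.

Set Implicit Arguments.
Unset Strict Implicit.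
Unset Printing Implicit Defensive.

Import Order.TTheory GRing.Theory Num.Theory.
Import numFieldNormedType.Exports.

Local Open Scope classical_set_scope.
Local Open Scope ring_scope.

(* The axiom of completeType, without the requirement that T be pointed. *)
Definition complete_space (T : uniformType) :=
  forall F : set_system T, ProperFilter F -> cauchy F ->
    exists l : T, F --> l.

Definition separable (T : topologicalType) :=
  exists2 S : set T, countable S & dense S.

Definition borel_set (T : topologicalType) : set_system T := <<s @open T >>.

Definition borel_map (T U : topologicalType) (f : T -> U) :=
  forall B, borel_set B -> borel_set (f @^-1` B).

Definition borel_reducible (T U : topologicalType)
    (E : T -> T -> Prop) (F : U -> U -> Prop) :=
  exists2 theta : T -> U, borel_map theta &
    forall x y, E x y <-> F (theta x) (theta y).

(* Convergence of a series of nonnegative terms is stated as finiteness of its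
   sum in the extended reals. *)
Definition E_metric {R : realType} (M : nat -> metricType R) (p : R)
    (x y : prod_topology M) : Prop :=
  (\sum_(n <oo) (mdist (x n) (y n) `^ p)%:E < +oo)%E.
Arguments E_metric {R} M p x y.

(* E_metric for the constant family X; normedModType has no inheritance to
   metricType, so the norm distance is spelled out. *)
Definition E_normed {R : realType} (X : normedModType R) (q : R)
    (x y : prod_topology (fun _ : nat => X)) : Prop :=
  (\sum_(n <oo) (`|x n - y n| `^ q)%:E < +oo)%E.
Arguments E_normed {R} X q x y.

Section lq.
Context {R : realType}.

Definition lq_sum (X : normedModType R) (q : R) (x : nat -> X) : \bar R :=
  (\sum_(n <oo) (`|x n| `^ q)%:E)%E.

Definition lq_pred (X : normedModType R) (q : R) : {pred (nat -> X)} :=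
  fun x => (lq_sum q x < +oo)%E.

Record lq (X : normedModType R) (q : R) (q1 : 1 <= q) :=
  Lq { lq_val :> nat -> X ; _ : lq_val \in lq_pred q }.

End lq.

Section lq_lmodule.
Context {R : realType} (X : normedModType R) (q : R) (q1 : 1 <= q).
Local Notation lq := (lq X q1).

HB.instance Definition _ := [isSub for @lq_val _ X q q1].
HB.instance Definition _ := [Choice of lq by <:].

Let q0 : 0 < q. Proof. exact: lt_le_trans q1. Qed.

Lemma lq_sum_ge0 (x : nat -> X) : (0 <= lq_sum q x)%E.
Proof. by apply: nneseries_ge0 => n _ _; rewrite lee_fin powR_ge0. Qed.

#[local] Hint Resolve lq_sum_ge0 : core.

Lemma lq_sumE (x : nat -> X) :
  (lq_sum q x `^ q^-1)%E = 'N[counting]_(q%:E)[EFin \o (fun n => `|x n|%R)]%E.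
Proof.
rewrite Lnorm_counting//; congr (_ `^ _)%E.
by apply: eq_eseriesr => n _ /=; rewrite normr_id.
Qed.

Lemma lq_sum_fin (x : nat -> X) : x \in @lq_pred _ X q -> lq_sum q x \is a fin_num.
Proof. by move=> xq; rewrite ge0_fin_numE. Qed.

Lemma lq_sumD (x y : nat -> X) :
  (lq_sum q (x + y)%R `^ q^-1 <= lq_sum q x `^ q^-1 + lq_sum q y `^ q^-1)%E.
Proof.
have H : (lq_sum q (x + y)%R `^ q^-1 <=
    'N[counting]_(q%:E)[EFin \o ((fun n => `|x n|%R) \+ (fun n => `|y n|%R))%R])%E.
  rewrite Lnorm_counting//; apply: gt0_ler_poweR.
  - by rewrite invr_ge0 ltW.
  - by rewrite in_itv /= leey andbT.
  - rewrite in_itv /= leey andbT.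
    by apply: nneseries_ge0 => n _ _; rewrite lee_fin powR_ge0.
  apply: lee_nneseries => n _ => [_|]; first by rewrite lee_fin powR_ge0.
  rewrite /= lee_fin ge0_ler_powR// ?nnegrE ?(ltW q0)//.
  by rewrite ger0_norm ?addr_ge0// ler_normD.
apply: (le_trans H); rewrite !lq_sumE; exact: minkowski_EFin.
Qed.

Lemma lq_powD (x y : nat -> X) : x \in @lq_pred _ X q -> y \in @lq_pred _ X q ->
  x + y \in @lq_pred _ X q.
Proof.
move=> xq yq; rewrite unfold_in /lq_pred ltey; apply/eqP => xyy.
have := lq_sumD x y; rewrite xyy /= gt_eqF ?invr_gt0// leye_eq.
by apply/negP; rewrite -ltey lte_add_pinfty// poweR_lty.
Qed.

Lemma lq_sumZ (a : R) (x : nat -> X) :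
  lq_sum q (a *: x) = ((`|a| `^ q)%:E * lq_sum q x)%E.
Proof.
rewrite /lq_sum -nneseriesZl//.
by apply: eq_eseriesr => n _; rewrite normrZ powRM.
Qed.

Lemma lq_submod_closed : submod_closed (@lq_pred _ X q).
Proof.
split=> [|a x y xq yq].
  rewrite unfold_in /lq_pred /lq_sum eseries0 ?ltry// => n _ _.
  by rewrite normr0 powR0// gt_eqF.
apply: lq_powD => //; rewrite unfold_in /lq_pred lq_sumZ.
by rewrite lte_mul_pinfty// lee_fin powR_ge0.
Qed.

HB.instance Definition _ :=
  GRing.isSubmodClosed.Build R (nat -> X) (@lq_pred _ X q) lq_submod_closed.
HB.instance Definition _ := [SubChoice_isSubLmodule of lq by <:].

Lemma lq_valD (x y : lq) : lq_val (x + y) = lq_val x + lq_val y.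
Proof. exact: (raddfD (\val : lq -> nat -> X)). Qed.

Lemma lq_valZ (a : R) (x : lq) : lq_val (a *: x) = a *: lq_val x.
Proof. exact: (linearZ_LR (\val : lq -> nat -> X)). Qed.

Lemma lq_val0 : lq_val (0 : lq) = 0.
Proof. exact: (raddf0 (\val : lq -> nat -> X)). Qed.

End lq_lmodule.

(* Locked, since unification would otherwise unfold powR and the series. *)
HB.lock Definition lq_norm {R : realType} (X : normedModType R) (q : R)
    (q1 : 1 <= q) (x : lq X q1) : R := fine (lq_sum q x) `^ q^-1.
Arguments lq_norm {R X q q1} x.

Section lq_normed.
Context {R : realType} (X : normedModType R) (q : R) (q1 : 1 <= q).
Local Notation lq := (lq X q1).

Let q0 : 0 < q. Proof. exact: lt_le_trans q1. Qed.

Lemma EFin_lq_norm (x : lq) : (lq_norm x)%:E = (lq_sum q x `^ q^-1)%E.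
Proof. by rewrite unlock -poweR_EFin fineK// lq_sum_fin//; case: x. Qed.

Let lq_normD (x y : lq) : lq_norm (x + y) <= lq_norm x + lq_norm y.
Proof. by rewrite -lee_fin EFinD !EFin_lq_norm lq_valD; exact: lq_sumD. Qed.

Let lq_normZ (a : R) (x : lq) : lq_norm (a *: x) = `|a| * lq_norm x.
Proof.
rewrite unlock lq_valZ lq_sumZ// fineM//; last by apply: lq_sum_fin; case: x.
by rewrite powRM ?powR_ge0 ?fine_ge0 ?lq_sum_ge0//=
  -powRrM divff ?gt_eqF// powRr1.
Qed.

Let lq_norm0_eq0 (x : lq) : lq_norm x = 0 -> x = 0.
Proof.
rewrite unlock => /powR_eq0_eq0/eqP.
rewrite fine_eq0; last by apply: lq_sum_fin; case: x.
move=> /eqP x0; apply/val_inj; rewrite [RHS]lq_val0; apply/funext => n /=.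
apply/eqP; rewrite -normr_eq0; apply/eqP/(@powR_eq0_eq0 _ _ q)/eqP.
have f0 k : true -> (0 <= (`|x k| `^ q)%:E)%E by rewrite lee_fin powR_ge0.
rewrite eq_le powR_ge0 andbT -lee_fin (le_trans _ (_ : lq_sum q x <= _)%E)//.
  rewrite /lq_sum (nneseriesD1 (n := n) f0)// leeDl//.
  by apply: nneseries_ge0 => k _ _; exact: f0.
by rewrite x0.
Qed.

HB.instance Definition _ :=
  Lmodule_isNormed.Build R lq lq_normD lq_normZ lq_norm0_eq0.

Lemma lq_normE (x : lq) :
  `|x| = fine (\sum_(n <oo) (`|x n| `^ q)%:E)%E `^ q^-1.
Proof. by rewrite -[LHS]/(lq_norm x) unlock. Qed.

End lq_normed.

(* Main.v *)
(* Fix a bijection e : N -> N * N and spread the sequences T_n (x n) over N by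
   theta x i := T_n (x n) k where e i = (n, k). By Tonelli, the series defining
   E(X, q) at (theta x, theta y) is sum_n ||T_n (x n) - T_n (y n)||^q, which
   hypotheses (1)-(4) make equiconvergent with sum_n d_n (x n) (y n)^p. The map
   theta is Borel because its coordinates are and X^N is second countable, so
   that cylinders over basic open sets generate the Borel sets of X^N. *)
Require Import Defs.
From HB Require Import structures.
From mathcomp Require Import all_boot all_order all_algebra.
From mathcomp Require Import all_classical all_reals all_analysis.

Set Implicit Arguments.
Unset Strict Implicit.
Unset Printing Implicit Defensive.

Import Order.TTheory GRing.Theory Num.Theory.
Import numFieldNormedType.Exports.

Local Open Scope classical_set_scope.
Local Open Scope ring_scope.

(** * Borel sets, and Borel maps into countable powers *)

Section borel.
Implicit Types T U : topologicalType.

(** The sets with Borel preimage form a sigma-algebra, which contains all Borel sets once it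
    contains the open ones. *)
Lemma borel_map_open T U (f : T -> U) :
  (forall O, open O -> borel_set (f @^-1` O)) -> borel_map f.
Proof.
move=> fo; suff : @borel_set U `<=` [set B | borel_set (f @^-1` B)] by [].
apply: smallest_sub => //; split=> [|B bB|F bF] /=.
- by rewrite preimage_set0; exact: sigma_algebra0.
- by rewrite setTD preimage_setC -setTD; exact: sigma_algebraCD.
- by rewrite preimage_bigcup; exact: sigma_algebra_bigcup.
Qed.

Lemma continuous_borel_map T U (f : T -> U) : continuous f -> borel_map f.
Proof.
move=> /continuousP fo; apply: borel_map_open => O oO.
by apply: sub_sigma_algebra; exact: fo.
Qed.

Lemma borel_map_comp T U (V : topologicalType) (f : T -> U) (g : U -> V) :
  borel_map f -> borel_map g -> borel_map (g \o f).
Proof. by move=> bf bg B bB; exact: (bf _ (bg _ bB)). Qed.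

Lemma borel_set_countable_bigcup T (I : Type) (D : set I)
    (F : I -> set T) : countable D -> (forall i, D i -> borel_set (F i)) ->
  borel_set (\bigcup_(i in D) F i).
Proof.
(* A nonempty countable index set is enumerated by a surjection from [nat], which turns the union
   into that of a sequence; the empty one is treated apart. *)
move=> /pfcard_geP[->|[g]] bF.
  by rewrite bigcup_set0; exact: sigma_algebra0.
rewrite -(image_eq g) bigcup_image; apply: sigma_algebra_bigcup => n.
by apply: bF; exact: funS.
Qed.

Lemma borel_set_finite_bigcap T (I : Type) (D : set I)
    (F : I -> set T) : finite_set D -> (forall i, D i -> borel_set (F i)) ->
  borel_set (\bigcap_(i in D) F i).
Proof.
move=> finD bF; rewrite -[X in borel_set X]setCK setC_bigcap -setTD.
apply: sigma_algebraCD; apply: borel_set_countable_bigcup => [|i Di].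
  exact: finite_set_countable.
by rewrite -setTD; apply: sigma_algebraCD; exact: bF.
Qed.

(** Countability of [B] makes every open set a countable union of basic sets, so its preimage stays
    in the sigma-algebra. *)
Lemma borel_map_basis T U (B : set (set U)) (f : T -> U) :
  countable B -> basis B -> (forall V, B V -> borel_set (f @^-1` V)) ->
  borel_map f.
Proof.
move=> cB [_ nB] bf; apply: borel_map_open => O oO.
have -> : O = \bigcup_(V in [set V | B V /\ V `<=` O]) V.
  apply/seteqP; split=> [x Ox|x [V [_]]]; last exact.
  have /nB[V [BV Vx] VO] : nbhs x O by exact: open_nbhs_nbhs.
  by exists V.
rewrite preimage_bigcup; apply: borel_set_countable_bigcup.
  by apply: sub_countable cB; apply: subset_card_le => V [].
by move=> V [BV _]; exact: bf.
Qed.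

Lemma separable_second_countable (R : realType)
    (X : pseudoMetricNormedZmodType R) : separable X -> @second_countable X.
Proof.
move=> [S cS dS].
exists (\bigcup_n [set ball s (n.+1%:R^-1 : R) | s in S]).
  apply: bigcup_countable => // n _.
  exact: card_le_trans (card_image_le _ _) _.
split=> [_ [n _ [s _ <-]]|x V /nbhs_ballP[e e0 eV]]; first exact: ball_open.
(* With radius below [e / 2], a ball around [s] that contains [x] lies in the [e]-ball around
   [x]. *)
have [n] : exists n, 0 + n.+1%:R^-1 < e / 2 :> R.
  by apply/ltr_add_invr; rewrite divr_gt0.
rewrite add0r => ne.
have [s [xs Ss]] : ball x (n.+1%:R^-1 : R) `&` S !=set0.
  by apply: dS; [exists x; exact: ballxx|exact: ball_open].
exists (ball s (n.+1%:R^-1 : R)); first split => //.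
- by exists n => //; exists s.
- exact: ball_sym.
apply: subset_trans eV => z sz; rewrite [e]splitr.
by apply: (@ball_triangle _ _ s); apply: le_ball (ltW ne) _ _.
Qed.

Lemma borel_map_prod T U (f : T -> prod_topology (fun _ : nat => U)) :
  @second_countable U -> (forall i, borel_map (fun x => f x i)) ->
  borel_map f.
Proof.
move=> [B cB [oB nB]] bf.
(* The cylinders over basic sets form a countable subbasis; their finite intersections will be the
   countable basis. *)
pose S := \bigcup_(i : nat)
  [set [set x : prod_topology (fun _ : nat => U) | V (x i)] | V in B].
have oS : S `<=` open.
  move=> _ [i _ [V BV <-]].
  have : continuous (proj i : prod_topology (fun _ : nat => U) -> U).
    exact: proj_continuous.
  by move=> /continuousP/(_ V (oB _ BV)).
apply: (@borel_map_basis _ _ (finI_from S id)).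
- apply: finI_from_countable; apply: bigcup_countable => // i _.
  exact: card_le_trans (card_image_le _ _) _.
- split=> [_ [E ES <-]|x].
    rewrite bigcap_fset big_seq; apply: big_ind => [|? ?|V]; first exact: openT.
      exact: openI.
    by move=> /ES/set_mem/oS.
  have FF : Filter (filter_from [set V | finI_from S id V /\ V x] id).
    apply: filter_from_filter => [|V W [SV Vx] [SW Wx]].
      have : [set: prod_topology (fun _ : nat => U)] x by [].
      by rewrite -(finI_from_cover S id) => -[V SV Vx]; exists V.
    by exists (V `&` W) => //; split => //; exact: finI_fromI.
  (* The product topology is a supremum of initial topologies, so convergence to [x] is checked one
     coordinate at a time. *)
  apply/cvg_sup => i V /= [_ [[W oW <-] Wx] WV].
  have /nB[Z [BZ Zx] ZW] : nbhs (x i) W by exact: open_nbhs_nbhs.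
  exists [set y : prod_topology (fun _ : nat => U) | Z (y i)].
    by split => //; apply: finI_from1; exists i => //; exists Z.
  by move=> y Zy; apply: WV; exact: ZW.
- move=> _ [E ES <-]; rewrite preimage_bigcap.
  apply: borel_set_finite_bigcap => //.
  move=> V /ES/set_mem[i _ [W BW <-]].
  by apply: (bf i); apply: sub_sigma_algebra; exact: oB.
Qed.

End borel.

(** * Series of nonnegative reals *)

Section nonnegative_series.
Context {R : realType}.
Implicit Types a f g : nat -> R.

Lemma nneseries_near_lt f (e : R) : (forall n, 0 <= f n) -> 0 < e ->
  (\sum_(n <oo) (f n)%:E < +oo)%E -> \forall n \near \oo, f n < e.
Proof.
move=> f0 e0 /(nnseries_is_cvg f0)/cvg_series_cvg_0/cvgr0Pnorm_lt/(_ _ e0).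
by apply: filterS => n; rewrite ger0_norm.
Qed.

Lemma nneseries_near_le_lty f a g (c : R) :
  (forall n, 0 <= f n) -> (forall n, 0 <= a n) -> (forall n, 0 <= g n) ->
  (\forall n \near \oo, f n <= a n + c * g n) ->
  (\sum_(n <oo) (a n)%:E < +oo)%E -> (\sum_(n <oo) (g n)%:E < +oo)%E ->
  (\sum_(n <oo) (f n)%:E < +oo)%E.
Proof.
move=> f0 a0 g0 [N _ fN] sa sg.
(* [h] carries the finitely many terms before [N], where the bound may fail. *)
pose h n := if (n < N)%N then f n else 0.
have h0 n : 0 <= h n by rewrite /h; case: ifP.
have sh : (\sum_(n <oo) (h n)%:E < +oo)%E.
  rewrite (nneseries_split 0 N) => [|k _]; last by rewrite lee_fin.
  rewrite add0n eseries0 => [|k Nk _]; last by rewrite /h ltnNge Nk.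
  by rewrite adde0 sumEFin ltry.
(* The sign of [c] is free; its absolute value keeps every summand nonnegative, as splitting the
   series requires. *)
apply: (@le_lt_trans _ _
    (\sum_(n <oo) ((a n)%:E + (`|c|)%:E * (g n)%:E + (h n)%:E))%E).
  apply: lee_nneseries => n _; first by rewrite lee_fin.
  rewrite -EFinM -!EFinD lee_fin /h; case: ltnP => nN.
    by rewrite lerDr addr_ge0 ?mulr_ge0.
  by rewrite addr0 (le_trans (fN _ nN))// lerD2l ler_wpM2r// ler_norm.
rewrite !nneseriesD ?nneseriesZl// => *;
  rewrite -?EFinM -?EFinD ?lee_fin ?addr_ge0 ?mulr_ge0//.
by rewrite !lte_add_pinfty// lte_mul_pinfty// lee_fin.
Qed.

(** Both sides equal the unordered sum of [f] over all pairs: reindexing along [e] gives the left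
    one, summing fibre by fibre the right one. *)
Lemma nneseries_pair (e : {bij [set: nat] >-> [set: nat * nat]})
    (f : nat -> nat -> R) :
  (forall n k, 0 <= f n k) ->
  (\sum_(i <oo) (f (e i).1 (e i).2)%:E =
   \sum_(n <oo) \sum_(k <oo) (f n k)%:E)%E.
Proof.
move=> f0; rewrite nneseries_esumT => [|n]; last by rewrite lee_fin.
rewrite -(@reindex_esum _ _ _ [set: nat] [set: nat * nat] e
  (fun k => (f k.1 k.2)%:E)); last exact: bij.
(* [esum_esum] expects a dependent product of sets, here with constant fibres. *)
transitivity (\esum_(k in [set: nat] `*`` (fun=> [set: nat])) (f k.1 k.2)%:E)%E.
  by congr esum; apply/seteqP.
rewrite -(@esum_esum _ _ _ _ _ (fun n k => (f n k)%:E)) => [|n k _ _];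
  last by rewrite lee_fin.
rewrite nneseries_esumT => [|n]; last first.
  by apply: nneseries_ge0 => k _ _; rewrite lee_fin.
by apply: eq_esum => n _; rewrite nneseries_esumT// => k; rewrite lee_fin.
Qed.

End nonnegative_series.

(** * Coordinates of elements of [lq] *)

Section lq_coordinates.
Context {R : realType} {X : normedModType R} {q : R} {q1 : 1 <= q}.

Let q0 : 0 < q. Proof. exact: lt_le_trans q1. Qed.

(** Membership in [lq] makes the sum finite, so [fine] loses nothing; this trades an inner series
    over coordinates for a norm. *)
Lemma powR_lq_norm (x : lq X q1) :
  ((`|x| `^ q)%:E = \sum_(n <oo) (`|x n| `^ q)%:E)%E.
Proof.
rewrite lq_normE -powRrM mulVf ?gt_eqF// powRr1; last first.
  by rewrite fine_ge0//; exact: lq_sum_ge0.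
by rewrite fineK//; apply: (@lq_sum_fin _ _ q); case: x.
Qed.

Lemma lq_valB (x y : lq X q1) n : (x - y) n = x n - y n.
Proof. by rewrite lq_valD -scaleN1r lq_valZ fctE/= scaleN1r. Qed.

(** After passing to [q]-th powers, one nonnegative term is at most the whole sum. *)
Lemma ler_lq_coord (x : lq X q1) n : `|x n| <= `|x|.
Proof.
rewrite leNgt; apply/negP => /(gt0_ltr_powR q0).
rewrite !nnegrE !normr_ge0 => /(_ isT isT); apply/negP; rewrite -leNgt.
rewrite -lee_fin powR_lq_norm (nneseriesD1 (n := n)) => [|k _|//].
  by rewrite leeDl//; apply: nneseries_ge0 => k _ _; rewrite lee_fin powR_ge0.
by rewrite lee_fin powR_ge0.
Qed.

(** Evaluation at [n] is linear and does not increase norms, hence 1-Lipschitz. *)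
Lemma continuous_lq_coord n : continuous (fun x : lq X q1 => x n).
Proof.
move=> x; apply/(@cvgrPdist_lt _ X _ (nbhs x)) => e e0.
apply/(@nbhs_ballP _ (lq X q1)); exists e => //= y.
rewrite -ball_normE /= => xy.
by rewrite -lq_valB (le_lt_trans (ler_lq_coord _ _)).
Qed.

End lq_coordinates.

(** * Equiconvergence of the two series, and the reduction *)

(* If either series converges, its terms eventually fall below [C `^ p]
   (resp. [D `^ q]), so that [C < d n] occurs only finitely often. *)
Lemma nneseries_powR_equiv (R : realType) (p q A C D : R)
    (d N eps delta : nat -> R) :
  0 < p -> 0 < q -> 0 < A -> 0 < C -> 0 < D ->
  (forall n, 0 <= d n) -> (forall n, 0 <= N n) ->
  (forall n, 0 <= eps n) -> (forall n, 0 <= delta n) ->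
  (\sum_(n <oo) (eps n `^ p)%:E < +oo)%E ->
  (\sum_(n <oo) (delta n `^ q)%:E < +oo)%E ->
  (forall n, d n < eps n -> N n < delta n) ->
  (forall n, C < d n -> D < N n) ->
  (forall n, eps n <= d n <= C ->
    A^-1 * d n `^ (p / q) <= N n <= A * d n `^ (p / q)) ->
  (\sum_(n <oo) (d n `^ p)%:E < +oo)%E <->
  (\sum_(n <oo) (N n `^ q)%:E < +oo)%E.
Proof.
move=> p0 q0 A0 C0 D0 d0 N0 eps0 delta0 seps sdelta small large holder.
(* Raising the Hölder bounds to the power [q] turns the exponent [p / q] into [p]. *)
have dpq n : (d n `^ (p / q)) `^ q = d n `^ p.
  by rewrite -powRrM divfK ?gt_eqF.
have mono r x y : 0 < r -> 0 <= x -> x <= y -> x `^ r <= y `^ r :> R.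
  by move=> r0 x0 xy; rewrite (ge0_ler_powR (ltW r0)) ?nnegrE ?(le_trans x0 xy).
split=> [sd|sN].
  (* The first series dominates the terms with [d n < eps n], the second those in the Hölder
     range. *)
  apply: (@nneseries_near_le_lty _ _ (fun n => delta n `^ q)
    (fun n => d n `^ p) (A `^ q)) => //; try by move=> n; rewrite powR_ge0.
  have := nneseries_near_lt (fun n => powR_ge0 (d n) p) (powR_gt0 p C0) sd.
  apply: filterS => n dC.
  have {}dC : d n <= C.
    by rewrite leNgt; apply: contraTN dC => /ltW Cd; rewrite -leNgt mono// ltW.
  have [dn|dn] := ltP (d n) (eps n).
    by rewrite (@le_trans _ _ (delta n `^ q)) ?mono ?(ltW (small _ dn))//
      lerDl mulr_ge0 ?powR_ge0.
  have /holder/andP[_ Nd] : eps n <= d n <= C by rewrite dn.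
  rewrite -dpq -powRM ?powR_ge0 ?(ltW A0)//.
  by rewrite (le_trans (mono _ _ _ q0 (N0 n) Nd))// lerDr powR_ge0.
(* The same case split; multiplying the lower Hölder bound by [A] before taking [q]-th powers again
   gives the [q]-th power of [A] as constant. *)
apply: (@nneseries_near_le_lty _ _ (fun n => eps n `^ p)
  (fun n => N n `^ q) (A `^ q)) => //; try by move=> n; rewrite powR_ge0.
have := nneseries_near_lt (fun n => powR_ge0 (N n) q) (powR_gt0 q D0) sN.
apply: filterS => n ND.
have {ND}dC : d n <= C.
  rewrite leNgt; apply: contraTN ND => /large/ltW DN.
  by rewrite -leNgt mono// ltW.
have [dn|dn] := ltP (d n) (eps n).
  by rewrite (@le_trans _ _ (eps n `^ p)) ?mono ?(ltW dn)//
    lerDl mulr_ge0 ?powR_ge0.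
have /holder/andP[+ _] : eps n <= d n <= C by rewrite dn.
rewrite ler_pdivrMl// => dN.
rewrite -dpq -powRM ?(ltW A0)//.
by rewrite (le_trans (mono _ _ _ q0 (powR_ge0 _ _) dN))// lerDr powR_ge0.
Qed.

Theorem theorem4p2 (R : realType) (X : completeNormedModType R)
    (p q : R) (p1 : 1 <= p) (q1 : 1 <= q)
    (M : nat -> metricType R)
    (sepX : separable X)
    (sepM : forall n, separable (M n))
    (complM : forall n, complete_space (M n))
    (A C D : R) (A0 : 0 < A) (C0 : 0 < C) (D0 : 0 < D)
    (T : forall n, M n -> lq X q1) (borelT : forall n, borel_map (T n))
    (eps delta : nat -> R)
    (eps0 : forall n, 0 <= eps n) (delta0 : forall n, 0 <= delta n)
    (sum_eps : (\sum_(n <oo) (eps n `^ p)%:E < +oo)%E)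
    (sum_delta : (\sum_(n <oo) (delta n `^ q)%:E < +oo)%E)
    (T_small : forall n (u v : M n), mdist u v < eps n ->
       `|T n u - T n v| < delta n)
    (T_large : forall n (u v : M n), C < mdist u v ->
       D < `|T n u - T n v|)
    (T_holder : forall n (u v : M n), eps n <= mdist u v <= C ->
       A^-1 * mdist u v `^ (p / q) <= `|T n u - T n v|
         <= A * mdist u v `^ (p / q)) :
  borel_reducible (E_metric M p) (E_normed X q).
Proof.
have p0 : 0 < p := lt_le_trans ltr01 p1.
have q0 : 0 < q := lt_le_trans ltr01 q1.
have [e] : $| {bij [set: nat] >-> [set: nat * nat]} |.
  by apply/pcard_eqP; rewrite card_eq_sym card_nat2.
exists (fun x i => T (e i).1 (x (e i).1) (e i).2).
  apply: borel_map_prod => [|i]; first exact: separable_second_countable.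
  (* Coordinate [i] of the map is a projection, then some [T n], then evaluation at an index. *)
  have bproj : borel_map (fun x : prod_topology M => x (e i).1).
    by apply: continuous_borel_map; exact: proj_continuous.
  have bcoord : borel_map (fun y : lq X q1 => y (e i).2).
    by apply: continuous_borel_map; exact: continuous_lq_coord.
  exact: borel_map_comp (borel_map_comp bproj (borelT (e i).1)) bcoord.
move=> x y; rewrite /E_metric /E_normed.
rewrite (nneseries_pair e (f := fun n k => `|T n (x n) k - T n (y n) k| `^ q));
  last by move=> n k; exact: powR_ge0.
(* Each inner series is the [q]-th power of an [lq] norm. *)
rewrite (eq_eseriesr (g := fun n => (`|T n (x n) - T n (y n)| `^ q)%:E));
  last first.
  move=> n _; rewrite powR_lq_norm.
  by apply: eq_eseriesr => k _; rewrite lq_valB.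
by apply: nneseries_powR_equiv A0 C0 D0 _ _ eps0 delta0 _ _ _ _ _ => // n;
  [exact: mdist_ge0|exact: T_small|exact: T_large|exact: T_holder].
Qed.
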